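(* Let $k$ be any field. The matrix algebras $A=M_n(k)$ (all $n\times n$ matrices), $B=\mathrm{Diag}_n(k)$ (diagonal $n\times n$ matrices) and $C=T_n(k)$ (upper triangular $n\times n$ matrices), so that $B\subseteq C\subseteq A$, satisfy: $A\mid B$ and $A\mid C$ are H-separable (and therefore D2), but $C\mid B$ is not D2.
   Context: Algebras are unital and associative, not necessarily commutative. An algebra extension $A\mid B$ is a unit-preserving algebra homomorphism $B\to A$ (here, an inclusion of a subalgebra). $X\oplus *\cong Y$ means $X$ is isomorphic to a direct summand of $Y$. $A\mid B$ is H-separable if $A\otimes_BA\oplus *\cong A^N$ as $A$-$A$-bimodules for some positive integer $N$. $A\mid B$ is left D2 (respectively right D2) if $A\otimes_BA\oplus *\cong A^N$ for some positive integer $N$ as $B$-$A$-bimodules (respectively $A$-$B$-bimodules); it is D2 (depth two) if it is both left and right D2.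
   Formalization: The claim that C|B is not D2 is stated only for n ≥ 2, since for n = 1 the algebras A, B and C all equal k and C|B is trivially D2; the other claims are stated for all n ≥ 1. *)

(* Defs.v *)
From HB Require Import structures.
From mathcomp Require Import all_boot all_algebra.
From mathcomp Require Import boolp.
From mathcomp Require Import ring_quotient freeg.

Set Implicit Arguments.
Unset Strict Implicit.
Unset Printing Implicit Defensive.

Import GRing.Theory.
Local Open Scope ring_scope.
Local Open Scope quotient_scope.

(* If R and S are algebras over k, no compatibility of the two k-actions is
   required here; it holds automatically in the regular bimodule of a
   k-algebra and is inherited by restrictions along k-algebra morphisms, by
   tensor products, by direct powers and by direct summands. *)
Record bimodType (R S : nzRingType) := BimodType {
  bimod_sort :> zmodType;
  lact : R -> bimod_sort -> bimod_sort;
  ract : bimod_sort -> S -> bimod_sort;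
  lactDr : forall r x y, lact r (x + y) = lact r x + lact r y;
  lactDl : forall r s x, lact (r + s) x = lact r x + lact s x;
  lactA : forall r s x, lact (r * s) x = lact r (lact s x);
  lact1 : forall x, lact 1 x = x;
  ractDl : forall s x y, ract (x + y) s = ract x s + ract y s;
  ractDr : forall r s x, ract x (r + s) = ract x r + ract x s;
  ractA : forall r s x, ract x (r * s) = ract (ract x r) s;
  ract1 : forall x, ract x 1 = x;
  lractA : forall r s x, ract (lact r x) s = lact r (ract x s)
}.

Section Isomorphism.
Variables R S : nzRingType.
Implicit Types M N : bimodType R S.

Definition bimod_morphism M N (f : M -> N) : Prop :=
  [/\ forall x y, f (x + y) = f x + f y,
      forall r x, f (lact r x) = lact r (f x)
    & forall x s, f (ract x s) = ract (f x) s].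

Definition bimod_iso M N : Prop :=
  exists2 f : M -> N, bimod_morphism f & bijective f.

End Isomorphism.

Section Constructions.
Variables R S : nzRingType.

Section DirectSum.
Variables M N : bimodType R S.
Definition dsum_lact r (x : (M * N)%type) : (M * N)%type :=
  (lact r x.1, lact r x.2).
Definition dsum_ract (x : (M * N)%type) s : (M * N)%type :=
  (ract x.1 s, ract x.2 s).

Definition dsum : bimodType R S.
Proof.
by apply: (@BimodType R S (M * N)%type dsum_lact dsum_ract);
   do ?move=> [? ?] ||move=> ?;
   rewrite /dsum_lact /dsum_ract /= ?(lactDr, lactDl, lactA, lact1,
     ractDl, ractDr, ractA, ract1, lractA).
Defined.
End DirectSum.

Section Power.
Variables (M : bimodType R S) (N : nat).
Definition power_lact r (x : {ffun 'I_N -> M}) : {ffun 'I_N -> M} :=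
  [ffun i => lact r (x i)].
Definition power_ract (x : {ffun 'I_N -> M}) s : {ffun 'I_N -> M} :=
  [ffun i => ract (x i) s].

Definition power : bimodType R S.
Proof.
by apply: (@BimodType R S {ffun 'I_N -> M} power_lact power_ract);
   move=> *; apply/ffunP=> i;
   rewrite !ffunE ?(lactDr, lactDl, lactA, lact1,
     ractDl, ractDr, ractA, ract1, lractA).
Defined.
End Power.

End Constructions.

Definition dsummand (R S : nzRingType) (X Y : bimodType R S) : Prop :=
  exists Z : bimodType R S, bimod_iso (dsum X Z) Y.

Definition regular (R : nzRingType) : bimodType R R.
Proof.
by apply: (@BimodType R R R *%R *%R) => *;
   rewrite ?(mulrDl, mulrDr, mulrA, mul1r, mulr1).
Defined.

Definition restrict (R S R' S' : nzRingType)
  (f : {rmorphism R' -> R}) (g : {rmorphism S' -> S}) (M : bimodType R S) :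
  bimodType R' S'.
Proof.
by apply: (@BimodType R' S' M (fun r x => lact (f r) x)
             (fun x s => ract x (g s))) => *;
   rewrite ?(rmorphD, rmorphM, rmorph1) ?(lactDr, lactDl, lactA, lact1,
     ractDl, ractDr, ractA, ract1, lractA).
Defined.

Section TensorProduct.
Variables (R B S : nzRingType) (M : bimodType R B) (N : bimodType B S).

Definition tens_free := {freeg (M * N)%type / int}.
Implicit Types u v : tens_free.

Inductive tens_null : tens_free -> Prop :=
| tens_null0 : tens_null 0
| tens_nullB u v : tens_null u -> tens_null v -> tens_null (u - v)
| tens_nullDl m m' n :
    tens_null (<< (m + m', n) >> - << (m, n) >> - << (m', n) >>)
| tens_nullDr m n n' :
    tens_null (<< (m, n + n') >> - << (m, n) >> - << (m, n') >>)
| tens_nullA m b n :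
    tens_null (<< (ract m b, n) >> - << (m, lact b n) >>).

Definition tens_nullp : {pred tens_free} := fun u => `[< tens_null u >].

Lemma tens_nullp_zmod_closed : zmod_closed tens_nullp.
Proof.
split; first exact/asboolP/tens_null0.
by move=> u v /asboolP ? /asboolP ?; apply/asboolP/tens_nullB.
Qed.

HB.instance Definition _ :=
  GRing.isZmodClosed.Build tens_free tens_nullp tens_nullp_zmod_closed.

Definition tens_sort : zmodType := Quotient.quot tens_nullp.

Definition pure_tensor (m : M) (n : N) : tens_sort :=
  \pi_tens_sort (<< (m, n) >> : tens_free).

Lemma tens_piP u v :
  reflect (tens_null (u - v)) (\pi_tens_sort u == \pi_tens_sort v).
Proof. by rewrite -Quotient.idealrBE; apply: asboolP. Qed.

Lemma tens_piD u v :
  \pi_tens_sort (u + v) = \pi_tens_sort u + \pi_tens_sort v.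
Proof. exact: raddfD. Qed.

Lemma tens_ind (P : tens_sort -> Prop) :
  (forall x y, P x -> P y -> P (x - y)) -> (forall m n, P (pure_tensor m n)) ->
  forall x, P x.
Proof.
move=> PB Pmn x; have P0: P 0 by rewrite -(subrr (pure_tensor 0 0)); apply: PB.
have PN y : P y -> P (- y) by move=> Py; rewrite -(sub0r y); apply: PB.
have PD y z : P y -> P z -> P (y + z).
  by move=> Py Pz; rewrite -(opprK z); apply: PB => //; apply: PN.
rewrite -(reprK x) -(freeg_sumE (repr x)) raddf_sum.
elim/big_ind: _ => // [[m n]] _; rewrite -[coeff _ _]intz -freegU_mulz raddfMz.
have PM k : P (\pi_tens_sort (<< (m, n) >> : tens_free) *+ k).
  by elim: k => // k IHk; rewrite mulrS; apply: PD => //; apply: Pmn.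
by case: (coeff _ _) => k /=; [apply: PM | apply/PN/PM].
Qed.

Lemma pure_tensorDl m m' n :
  pure_tensor (m + m') n = pure_tensor m n + pure_tensor m' n.
Proof.
by rewrite /pure_tensor -[RHS]tens_piD; apply/eqP/tens_piP; rewrite opprD addrA;
   apply: tens_nullDl.
Qed.

Lemma pure_tensorDr m n n' :
  pure_tensor m (n + n') = pure_tensor m n + pure_tensor m n'.
Proof.
by rewrite /pure_tensor -[RHS]tens_piD; apply/eqP/tens_piP; rewrite opprD addrA;
   apply: tens_nullDr.
Qed.

Lemma pure_tensorA m b n : pure_tensor (ract m b) n = pure_tensor m (lact b n).
Proof. exact/eqP/tens_piP/tens_nullA. Qed.

Section Map.
Variables (hM : M -> M) (hN : N -> N).

Definition tens_map_free : tens_free -> tens_free :=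
  fglift (fun p => << (hM p.1, hN p.2) >> : tens_free).

Definition tens_map (x : tens_sort) : tens_sort :=
  \pi_tens_sort (tens_map_free (repr x)).

Lemma tens_map_freeB u v :
  tens_map_free (u - v) = tens_map_free u - tens_map_free v.
Proof. exact: lift_is_additive. Qed.

Lemma tens_map_freeU m n : tens_map_free << (m, n) >> = << (hM m, hN n) >>.
Proof. by rewrite /tens_map_free liftU scale1r. Qed.

Hypotheses (hMD : forall m m', hM (m + m') = hM m + hM m')
  (hMB : forall m b, hM (ract m b) = ract (hM m) b)
  (hND : forall n n', hN (n + n') = hN n + hN n')
  (hNB : forall n b, hN (lact b n) = lact b (hN n)).

Lemma tens_map_null u : tens_null u -> tens_null (tens_map_free u).
Proof.
elim=> [|v w _ v0 _ w0|m m' n|m n n'|m b n].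
- by rewrite -(subrr 0) tens_map_freeB subrr; apply: tens_null0.
- by rewrite tens_map_freeB; apply: tens_nullB.
- by rewrite !tens_map_freeB !tens_map_freeU hMD; apply: tens_nullDl.
- by rewrite !tens_map_freeB !tens_map_freeU hND; apply: tens_nullDr.
- by rewrite !tens_map_freeB !tens_map_freeU hMB hNB; apply: tens_nullA.
Qed.

Lemma tens_map_pi u :
  tens_map (\pi_tens_sort u) = \pi_tens_sort (tens_map_free u).
Proof.
apply/eqP/tens_piP; rewrite -tens_map_freeB; apply: tens_map_null.
by apply/tens_piP; rewrite reprK.
Qed.

Lemma tens_mapB x y : tens_map (x - y) = tens_map x - tens_map y.
Proof.
rewrite -(reprK x) -(reprK y) -raddfB !tens_map_pi tens_map_freeB.
exact: raddfB.
Qed.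

Lemma tens_mapD x y : tens_map (x + y) = tens_map x + tens_map y.
Proof.
have tens_map0 : tens_map 0 = 0 by rewrite -(subrr 0) tens_mapB !subrr.
by rewrite -{1}(opprK y) tens_mapB -(sub0r y) tens_mapB tens_map0 sub0r opprK.
Qed.

Lemma tens_mapU m n : tens_map (pure_tensor m n) = pure_tensor (hM m) (hN n).
Proof. by rewrite tens_map_pi tens_map_freeU. Qed.

End Map.
End TensorProduct.

Section TensorBimodule.
Variables (R B S : nzRingType) (M : bimodType R B) (N : bimodType B S).

Definition tensor_lact (r : R) : tens_sort M N -> tens_sort M N :=
  tens_map (lact r) id.
Definition tensor_ract (x : tens_sort M N) (s : S) : tens_sort M N :=
  tens_map id (fun n => ract n s) x.

Lemma tensor_lactU r m n :
  tensor_lact r (pure_tensor m n) = pure_tensor (lact r m) n.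
Proof. by apply: tens_mapU => // *; rewrite ?lactDr ?lractA. Qed.

Lemma tensor_ractU m n s :
  tensor_ract (pure_tensor m n) s = pure_tensor m (ract n s).
Proof. by apply: tens_mapU => // *; rewrite ?ractDl ?lractA. Qed.

Lemma tensor_lactDr r x y :
  tensor_lact r (x + y) = tensor_lact r x + tensor_lact r y.
Proof. by apply: tens_mapD => // *; rewrite ?lactDr ?lractA. Qed.

Lemma tensor_ractDl s x y :
  tensor_ract (x + y) s = tensor_ract x s + tensor_ract y s.
Proof. by apply: tens_mapD => // *; rewrite ?ractDl ?lractA. Qed.

Lemma tensor_lactB r x y :
  tensor_lact r (x - y) = tensor_lact r x - tensor_lact r y.
Proof. by apply: tens_mapB => // *; rewrite ?lactDr ?lractA. Qed.

Lemma tensor_ractB s x y :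
  tensor_ract (x - y) s = tensor_ract x s - tensor_ract y s.
Proof. by apply: tens_mapB => // *; rewrite ?ractDl ?lractA. Qed.

Lemma tensor_lactDl r s x :
  tensor_lact (r + s) x = tensor_lact r x + tensor_lact s x.
Proof.
elim/tens_ind: x => [x y IHx IHy|m n].
  by rewrite !tensor_lactB IHx IHy opprD addrACA.
by rewrite !tensor_lactU lactDl pure_tensorDl.
Qed.

Lemma tensor_lactA r s x :
  tensor_lact (r * s) x = tensor_lact r (tensor_lact s x).
Proof.
elim/tens_ind: x => [x y IHx IHy|m n]; first by rewrite !tensor_lactB IHx IHy.
by rewrite !tensor_lactU lactA.
Qed.

Lemma tensor_lact1 x : tensor_lact 1 x = x.
Proof.
elim/tens_ind: x => [x y IHx IHy|m n]; first by rewrite tensor_lactB IHx IHy.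
by rewrite tensor_lactU lact1.
Qed.

Lemma tensor_ractDr r s x :
  tensor_ract x (r + s) = tensor_ract x r + tensor_ract x s.
Proof.
elim/tens_ind: x => [x y IHx IHy|m n].
  by rewrite !tensor_ractB IHx IHy opprD addrACA.
by rewrite !tensor_ractU ractDr pure_tensorDr.
Qed.

Lemma tensor_ractA r s x :
  tensor_ract x (r * s) = tensor_ract (tensor_ract x r) s.
Proof.
elim/tens_ind: x => [x y IHx IHy|m n]; first by rewrite !tensor_ractB IHx IHy.
by rewrite !tensor_ractU ractA.
Qed.

Lemma tensor_ract1 x : tensor_ract x 1 = x.
Proof.
elim/tens_ind: x => [x y IHx IHy|m n]; first by rewrite tensor_ractB IHx IHy.
by rewrite tensor_ractU ract1.
Qed.

Lemma tensor_lractA r s x :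
  tensor_ract (tensor_lact r x) s = tensor_lact r (tensor_ract x s).
Proof.
elim/tens_ind: x => [x y IHx IHy|m n].
  by rewrite !(tensor_lactB, tensor_ractB) IHx IHy.
by rewrite !(tensor_lactU, tensor_ractU).
Qed.

Definition tensor : bimodType R S :=
  BimodType tensor_lactDr tensor_lactDl tensor_lactA tensor_lact1
    tensor_ractDl tensor_ractDr tensor_ractA tensor_ract1 tensor_lractA.

End TensorBimodule.

Section Extension.
Variables (k : fieldType) (A B : algType k) (f : {lrmorphism B -> A}).

Definition tensor_square : bimodType A A :=
  tensor (restrict idfun f (regular A)) (restrict f idfun (regular A)).

Definition H_separable : Prop :=
  exists2 N : nat, (0 < N)%N & dsummand tensor_square (power (regular A) N).

Definition left_D2 : Prop :=
  exists2 N : nat, (0 < N)%N &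
    dsummand (restrict f idfun tensor_square)
             (restrict f idfun (power (regular A) N)).

Definition right_D2 : Prop :=
  exists2 N : nat, (0 < N)%N &
    dsummand (restrict idfun f tensor_square)
             (restrict idfun f (power (regular A) N)).

Definition D2 : Prop := left_D2 /\ right_D2.

End Extension.

(* Matrices of size n.+1, so that they form a nontrivial ring. *)
Section MatrixAlgebras.
Variables (k : fieldType) (n : nat).
Local Notation Mn := 'M[k]_n.+1.

Definition diagp : {pred Mn} := @is_diag_mx k n.+1 n.+1.

(* is_trig_mx is lower triangularity. *)
Definition triup : {pred Mn} := fun a => is_trig_mx a^T.

Lemma triupP (a : Mn) : reflect (forall i j : 'I_n.+1, (j < i)%N -> a i j = 0)
  (a \in triup).
Proof.
rewrite unfold_in; apply: (iffP (@is_trig_mxP _ _ _ a^T)) => H i j ij;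
  by have := H j i ij; rewrite mxE.
Qed.

Lemma diagp_subalg_closed : GRing.subalg_closed diagp.
Proof.
split=> [|c a b /is_diag_mxP ad /is_diag_mxP bd|
          a b /is_diag_mxP ad /is_diag_mxP bd]; apply/is_diag_mxP=> i j ij.
- by rewrite mxE (_ : i == j = false) //; apply: negbTE.
- by rewrite !mxE ad // bd // mulr0 addr0.
- rewrite mxE big1 // => l _; have [il|il] := eqVneq (i : nat) l.
    by rewrite bd ?mulr0 // -il.
  by rewrite ad ?mul0r.
Qed.

Lemma triup_subalg_closed : GRing.subalg_closed triup.
Proof.
split=> [|c a b /triupP au /triupP bu|a b /triupP au /triupP bu];
  apply/triupP=> i j ji.
- by rewrite mxE (_ : i == j = false) //; apply/negbTE; rewrite neq_ltn ji orbT.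
- by rewrite !mxE au // bu // mulr0 addr0.
- rewrite mxE big1 // => l _; have [li|il] := ltnP l i.
    by rewrite au ?mul0r.
  by rewrite bu ?mulr0 // (leq_trans ji).
Qed.

Lemma sub_diagp_triup : {subset diagp <= triup}.
Proof.
move=> a /is_diag_mxP ad; apply/triupP=> i j ji.
by rewrite ad // neq_ltn ji orbT.
Qed.

HB.instance Definition _ := GRing.isSubalgClosed.Build k Mn diagp
  (GRing.subalg_closed_semi diagp_subalg_closed).
HB.instance Definition _ := GRing.isSubalgClosed.Build k Mn triup
  (GRing.subalg_closed_semi triup_subalg_closed).

Record Diag := MkDiag { Diag_val :> Mn; _ : Diag_val \in diagp }.
HB.instance Definition _ := [isSub for Diag_val].
HB.instance Definition _ := [Choice of Diag by <:].
HB.instance Definition _ := [SubChoice_isSubAlgebra of Diag by <:].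

Record Triu := MkTriu { Triu_val :> Mn; _ : Triu_val \in triup }.
HB.instance Definition _ := [isSub for Triu_val].
HB.instance Definition _ := [Choice of Triu by <:].
HB.instance Definition _ := [SubChoice_isSubAlgebra of Triu by <:].

Lemma Diag_val_linear : linear Diag_val. Proof. by []. Qed.
Lemma Diag_val_monoid_morphism : monoid_morphism Diag_val. Proof. by []. Qed.
HB.instance Definition _ :=
  GRing.isLinear.Build k Diag Mn _ Diag_val Diag_val_linear.
HB.instance Definition _ :=
  GRing.isMonoidMorphism.Build Diag Mn Diag_val Diag_val_monoid_morphism.

Lemma Triu_val_linear : linear Triu_val. Proof. by []. Qed.
Lemma Triu_val_monoid_morphism : monoid_morphism Triu_val. Proof. by []. Qed.
HB.instance Definition _ :=
  GRing.isLinear.Build k Triu Mn _ Triu_val Triu_val_linear.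
HB.instance Definition _ :=
  GRing.isMonoidMorphism.Build Triu Mn Triu_val Triu_val_monoid_morphism.

Definition Diag_in_Triu (d : Diag) : Triu :=
  MkTriu (sub_diagp_triup (valP d)).

Lemma Diag_in_Triu_linear : linear Diag_in_Triu.
Proof. by move=> c x y; apply: val_inj. Qed.

Lemma Diag_in_Triu_monoid_morphism : monoid_morphism Diag_in_Triu.
Proof. by split=> [|x y]; apply: val_inj. Qed.

HB.instance Definition _ :=
  GRing.isLinear.Build k Diag Triu _ Diag_in_Triu Diag_in_Triu_linear.
HB.instance Definition _ :=
  GRing.isMonoidMorphism.Build Diag Triu Diag_in_Triu
    Diag_in_Triu_monoid_morphism.

End MatrixAlgebras.

(* Main.v *)
Require Import Defs.
From mathcomp Require Import all_boot all_algebra.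
From HB Require Import structures.
From mathcomp Require Import ring_quotient freeg.

(** Write [E i j] for the matrix units of [A = M_n(k)], and take [f : B -> A] to
    be the inclusion of a subalgebra.

    H-separability comes from Casimir elements.  Suppose that [e_i] in the
    tensor square of [A] over [B] commute with [A], that [r_i] in [A] commute
    with [B], and that the sum of the [r_i e_i] is [1 (x) 1].  Then
    [x (x) y |-> (x r_i y)_i] and [(a_i)_i |-> \sum_i a_i e_i] exhibit the
    tensor square as a retract of a power of [A] ([H_separable_casimir]), hence
    as a direct summand ([dsummand_retract]).  Over every subalgebra the
    elements [\sum_l E l j (x) E j l] commute with [A] ([mx_casimirC]).  Over the
    diagonal matrices the [r_j = E j j] complete them; over the upper
    triangular ones the [E 0 l] can be moved across the tensor sign, so the
    Casimir element for [j = 0] is already [1 (x) 1].  Restricting the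
    actions of a splitting gives depth two ([H_separable_D2]).

    For matrices of size at least two, the triangular algebra [C] is not even
    left D2 over the diagonal algebra.  With [m] the last index, [t = E 0 m (x) E m m] satisfies
    [E 0 0 t = t = t E m m], so a [B]-[C]-bimodule map [p] to a power of [C]
    sends it to a vector of multiples of [E 0 m = E 0 0 E 0 m], that is, to
    [w E 0 m] for some vector [w].  A retraction of [p] then shows that [t] lies
    in the submodule of the right multiples of [E 0 m].  But the functional
    [x (x) y |-> x_(0, m) y_(m, m)] is [1] on [t], and it kills that submodule
    because [(y E 0 m)_(m, m) = y_(m, 0) = 0] for triangular [y]
    ([not_left_D2_Diag_in_Triu]).  In module terms, [t] generates a copy of the
    projective [E m m C] inside [E 0 0 (C (x)_B C)], which is not a summand of a
    power of [E 0 0 C]. *)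

Set Implicit Arguments.
Unset Strict Implicit.
Unset Printing Implicit Defensive.

Import GRing.Theory.
Local Open Scope ring_scope.

(** * Direct summands and retracts of bimodules *)

Section Summands.
Variables R S : nzRingType.
Implicit Types X Y : bimodType R S.

Lemma bimod_morphismB X Y (f : X -> Y) :
  bimod_morphism f -> {morph f : x y / x - y}.
Proof. by case=> fD _ _ x y; apply: (addIr (f y)); rewrite -fD !subrK. Qed.

Lemma bimod_morphism0 X Y (f : X -> Y) : bimod_morphism f -> f 0 = 0.
Proof. by move=> fP; rewrite -(subrr 0) bimod_morphismB // subrr. Qed.

Lemma lact0 X r : lact r (0 : X) = 0.
Proof. by apply: (addIr (lact r 0)); rewrite -lactDr !add0r. Qed.

Lemma ract0 X s : ract (0 : X) s = 0.
Proof. by apply: (addIr (ract 0 s)); rewrite -ractDl !add0r. Qed.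

Lemma lactB X r (x y : X) : lact r (x - y) = lact r x - lact r y.
Proof. by apply: (addIr (lact r y)); rewrite -lactDr !subrK. Qed.

Lemma ractB X (x y : X) s : ract (x - y) s = ract x s - ract y s.
Proof. by apply: (addIr (ract y s)); rewrite -ractDl !subrK. Qed.

Lemma lact_sum X r (I : finType) (F : I -> X) :
  lact r (\sum_i F i) = \sum_i lact r (F i).
Proof. exact: (big_morph (lact r) (lactDr r) (lact0 X r)). Qed.

Lemma ract_sum X (I : finType) (F : I -> X) s :
  ract (\sum_i F i) s = \sum_i ract (F i) s.
Proof. exact: (big_morph (fun x => ract x s) (ractDl s) (ract0 X s)). Qed.

Section Kernel.
Variables (X Y : bimodType R S) (q : Y -> X).
Hypothesis qP : bimod_morphism q.

Definition in_kernel : {pred Y} := fun y => q y == 0.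

Lemma kernel_zmod_closed : zmod_closed in_kernel.
Proof.
split=> [|x y /eqP qx /eqP qy]; apply/eqP; first exact: bimod_morphism0.
by rewrite bimod_morphismB // qx qy subrr.
Qed.

HB.instance Definition _ :=
  GRing.isZmodClosed.Build Y in_kernel kernel_zmod_closed.

Record kernel_sort := KernelElt { kernel_val :> Y; _ : kernel_val \in in_kernel }.
HB.instance Definition _ := [isSub for kernel_val].
HB.instance Definition _ := [Choice of kernel_sort by <:].
HB.instance Definition _ := [SubChoice_isSubZmodule of kernel_sort by <:].

Lemma kernel_lactP r (z : kernel_sort) : lact r (val z) \in in_kernel.
Proof.
by case: qP => _ qL _; apply/eqP; rewrite qL (eqP (valP z)) lact0.
Qed.

Lemma kernel_ractP (z : kernel_sort) s : ract (val z) s \in in_kernel.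
Proof.
by case: qP => _ _ qR; apply/eqP; rewrite qR (eqP (valP z)) ract0.
Qed.

Definition kernel : bimodType R S.
Proof.
by apply: (@BimodType R S kernel_sort
    (fun r z => KernelElt (kernel_lactP r z))
    (fun z s => KernelElt (kernel_ractP z s))) => *; apply: val_inj;
  rewrite /= ?(lactDr, lactDl, lactA, lact1, ractDl, ractDr, ractA, ract1,
    lractA).
Defined.

(** The complement is the kernel of the retraction [q], through
    [y = p (q y) + (y - p (q y))]. *)
Lemma dsummand_retract (p : X -> Y) :
  bimod_morphism p -> cancel p q -> dsummand X Y.
Proof.
move=> pP pK; have [pD pL pR] := pP; have [qD qL qR] := qP.
exists kernel; exists (fun x : dsum X kernel => p x.1 + val x.2).
  split=> [x y|r x|x s] /=.
  - by rewrite pD addrACA.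
  - by rewrite pL lactDr.
  - by rewrite pR ractDl.
have defect_ker y : y - p (q y) \in in_kernel.
  by apply/eqP; rewrite bimod_morphismB // pK subrr.
exists (fun y => (q y, KernelElt (defect_ker y))) => [[x z]|y] /=.
  have qpz : q (p x + val z) = x by rewrite qD pK (eqP (valP z)) addr0.
  by congr pair => //; apply: val_inj; rewrite /= qpz addrC addKr.
by rewrite addrC subrK.
Qed.

End Kernel.

Lemma retract_dsummand X Y : dsummand X Y ->
  exists p : X -> Y, exists q : Y -> X,
    [/\ bimod_morphism p, bimod_morphism q & cancel p q].
Proof.
case=> Z [f [fD fL fR] [g gK fK]].
exists (fun x => f (x, 0)), (fun y => (g y).1); split=> [||x]; last by rewrite gK.
  split=> [x y|r x|x s].
  - by rewrite -fD /= /GRing.add /= /add_pair /= addr0.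
  - by rewrite -fL /= /dsum_lact /= lact0.
  - by rewrite -fR /= /dsum_ract /= ract0.
have f_inj := can_inj gK.
split=> [x y|r x|x s].
- by rewrite (_ : g (x + y) = g x + g y) //; apply: f_inj; rewrite fD !fK.
- by rewrite (_ : g (lact r x) = lact r (g x)) //; apply: f_inj; rewrite fL !fK.
- by rewrite (_ : g (ract x s) = ract (g x) s) //; apply: f_inj; rewrite fR !fK.
Qed.

End Summands.

(** The underlying group of a restricted direct sum is the same group, so one
    isomorphism serves for every restriction. *)
Lemma dsummand_restrict (R S R' S' : nzRingType)
    (f : {rmorphism R' -> R}) (g : {rmorphism S' -> S}) (X Y : bimodType R S) :
  dsummand X Y -> dsummand (restrict f g X) (restrict f g Y).
Proof.
case=> Z [h [hD hL hR] hB]; exists (restrict f g Z), h => //.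
by split=> [x y|r x|x s]; [apply: hD | apply: hL | apply: hR].
Qed.

Lemma H_separable_D2 (k : fieldType) (A B : algType k) (f : {lrmorphism B -> A}) :
  H_separable f -> D2 f.
Proof.
by case=> N N_gt0 sum_AA; split; exists N => //; apply: dsummand_restrict.
Qed.

(** * Maps out of a tensor product *)

Section TensorLift.
Variables (R B S : nzRingType) (M : bimodType R B) (N : bimodType B S).
Variables (V : zmodType) (g : M -> N -> V).
Hypotheses (gDl : forall m m' n, g (m + m') n = g m n + g m' n)
  (gDr : forall m n n', g m (n + n') = g m n + g m n')
  (gA : forall m b n, g (ract m b) n = g m (lact b n)).

(* [fglift] needs a module target, hence the view of [V] as a module over the
   integers. *)
Let gfree : tens_free M N -> V :=
  fglift (fun p => g p.1 p.2 : ssrint.zmodule V).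

Let gfreeB u v : gfree (u - v) = gfree u - gfree v.
Proof.
exact: (@lift_is_additive _ _ (ssrint.zmodule V) (fun p => g p.1 p.2)).
Qed.

Let gfreeU m n : gfree << (m, n) >> = g m n.
Proof. by rewrite /gfree liftU scale1r. Qed.

Let gfree_null u : tens_null u -> gfree u = 0.
Proof.
elim=> [|v w _ v0 _ w0|m m' n|m n n'|m b n].
- by rewrite -[in LHS](subrr 0) gfreeB subrr.
- by rewrite gfreeB v0 w0 subrr.
- by rewrite !gfreeB !gfreeU gDl -addrA -opprD subrr.
- by rewrite !gfreeB !gfreeU gDr -addrA -opprD subrr.
- by rewrite gfreeB !gfreeU gA subrr.
Qed.

(** The universal property of the tensor product: a balanced biadditive map
    kills the relations, so its extension to the free group can be evaluated on
    representatives of the classes. *)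
Lemma tensor_lift : exists phi : {additive tens_sort M N -> V},
  forall m n, phi (pure_tensor m n) = g m n.
Proof.
pose phi (x : tens_sort M N) : V := gfree (repr x).
have phi_pi u : phi (\pi_(tens_sort M N) u)%qT = gfree u.
  apply/eqP; rewrite -subr_eq0 -gfreeB; apply/eqP/gfree_null.
  by apply/tens_piP; rewrite reprK.
have phiB : zmod_morphism phi.
  by move=> x y; rewrite -(reprK x) -(reprK y) -raddfB !phi_pi gfreeB.
pose phi_additive := GRing.isZmodMorphism.Build _ _ phi phiB.
pose phiA : {additive _ -> _} := HB.pack phi phi_additive.
by exists phiA => m n; rewrite -gfreeU; apply: phi_pi.
Qed.

End TensorLift.

(** * The tensor square of an algebra extension *)

Section TensorSquare.
Variables (k : fieldType) (A B : algType k) (f : {lrmorphism B -> A}).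

(** [pure_tensor] with both factors read in [A]; the bimodule structures that it
    needs cannot be inferred from the elements. *)
Definition otimes (x y : A) : tensor_square f :=
  pure_tensor (x : restrict idfun f (regular A))
    (y : restrict f idfun (regular A)).

Lemma otimesDl x x' y : otimes (x + x') y = otimes x y + otimes x' y.
Proof. exact: pure_tensorDl. Qed.

Lemma otimesDr x y y' : otimes x (y + y') = otimes x y + otimes x y'.
Proof. exact: pure_tensorDr. Qed.

Lemma otimes0l y : otimes 0 y = 0.
Proof. by apply: (addIr (otimes 0 y)); rewrite -otimesDl !add0r. Qed.

Lemma otimes0r x : otimes x 0 = 0.
Proof. by apply: (addIr (otimes x 0)); rewrite -otimesDr !add0r. Qed.

Lemma otimes_sumr x (I : finType) (F : I -> A) :
  otimes x (\sum_i F i) = \sum_i otimes x (F i).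
Proof. exact: (big_morph (otimes x) (otimesDr x) (otimes0r x)). Qed.

Lemma otimes_suml (I : finType) (F : I -> A) y :
  otimes (\sum_i F i) y = \sum_i otimes (F i) y.
Proof.
exact: (big_morph (otimes^~ y) (fun x x' => otimesDl x x' y) (otimes0l y)).
Qed.

Lemma otimesA x b y : otimes (x * f b) y = otimes x (f b * y).
Proof. exact: pure_tensorA. Qed.

(** Scalars are balanced because [f], being unital and linear, has them in its
    image. *)
Lemma otimesZ c x y : otimes (c *: x) y = otimes x (c *: y).
Proof.
by have := otimesA x c%:A y; rewrite rmorph_alg mulr_algl -scalerAr mulr1.
Qed.

Lemma lact_otimes a x y : lact a (otimes x y) = otimes (a * x) y.
Proof. exact: tensor_lactU. Qed.

Lemma ract_otimes x y a : ract (otimes x y) a = otimes x (y * a).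
Proof. exact: tensor_ractU. Qed.

Lemma otimes_ind (P : tensor_square f -> Prop) :
    (forall x y, P x -> P y -> P (x - y)) -> (forall x y, P (otimes x y)) ->
  forall z, P z.
Proof. exact: tens_ind. Qed.

Lemma otimes_lift (V : zmodType) (g : A -> A -> V) :
    (forall x x' y, g (x + x') y = g x y + g x' y) ->
    (forall x y y', g x (y + y') = g x y + g x y') ->
    (forall x b y, g (x * f b) y = g x (f b * y)) ->
  exists phi : {additive tensor_square f -> V},
    forall x y, phi (otimes x y) = g x y.
Proof.
move=> gDl gDr gA.
exact: (@tensor_lift _ _ _ (restrict idfun f (regular A))
  (restrict f idfun (regular A)) V g gDl gDr gA).
Qed.

End TensorSquare.

(** * H-separability from Casimir elements *)

Section Criterion.
Variables (k : fieldType) (A B : algType k) (f : {lrmorphism B -> A}).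

(** The maps [p : x (x) y |-> (x r_i y)_i] and [q : a |-> \sum_i a_i e_i] are
    bimodule maps by the two commutation hypotheses, and
    [q (p (x (x) y)) = x (\sum_i r_i e_i) y]. *)
Lemma H_separable_casimir (N : nat)
    (e : 'I_N -> tensor_square f) (r : 'I_N -> A) : (0 < N)%N ->
    (forall i a, lact a (e i) = ract (e i) a) ->
    (forall i b, r i * f b = f b * r i) ->
    \sum_i lact (r i) (e i) = otimes f 1 1 ->
  H_separable f.
Proof.
move=> N_gt0 eC rC sum_re; exists N => //.
pose AN : bimodType A A := power (regular A) N.
have [||x b y|p pE] := @otimes_lift _ _ _ f AN
  (fun x y => [ffun i => x * r i * y]).
- by move=> x x' y; apply/ffunP=> i; rewrite !ffunE !mulrDl.
- by move=> x y y'; apply/ffunP=> i; rewrite !ffunE !mulrDr.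
- by apply/ffunP=> i; rewrite !ffunE -(mulrA x) -rC !mulrA.
have pP : bimod_morphism (p : tensor_square f -> AN).
  split=> [x y|a z|z a]; first exact: raddfD.
  - elim/otimes_ind: z => [x y IHx IHy|x y].
      by rewrite lactB !raddfB lactB IHx IHy.
    by rewrite lact_otimes !pE; apply/ffunP=> i; rewrite !ffunE /= !mulrA.
  - elim/otimes_ind: z => [x y IHx IHy|x y].
      by rewrite ractB !raddfB ractB IHx IHy.
    by rewrite ract_otimes !pE; apply/ffunP=> i; rewrite !ffunE /= !mulrA.
pose q (v : AN) : tensor_square f := \sum_i lact (v i : A) (e i).
have qP : bimod_morphism q.
  split=> [u v|a v|v a]; rewrite /q.
  - by rewrite -big_split; apply: eq_bigr => i _; rewrite ffunE lactDl.
  - by rewrite lact_sum; apply: eq_bigr => i _; rewrite ffunE lactA.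
  - by rewrite ract_sum; apply: eq_bigr => i _; rewrite ffunE lactA lractA eC.
apply: (dsummand_retract qP pP); elim/otimes_ind => [x y IHx IHy|x y].
  by rewrite raddfB bimod_morphismB // IHx IHy.
rewrite pE -[in RHS](mulr1 x) -[in RHS](mul1r y) -lact_otimes -ract_otimes.
rewrite -sum_re ract_sum lact_sum.
by apply: eq_bigr => i _; rewrite ffunE !lactA lractA -eC.
Qed.

End Criterion.

(** * Casimir elements of matrix algebras *)

Section MatrixCasimir.
Variables (k : fieldType) (n : nat).
Local Notation Mn := 'M[k]_n.+1.

Lemma mul_mx_delta (a : Mn) l j :
  a * delta_mx l j = \sum_m a m l *: (delta_mx m j : Mn).
Proof.
rewrite [a in LHS]matrix_sum_delta mulr_suml; apply: eq_bigr => m _.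
rewrite mulr_suml (bigD1 l) //= -scalerAl -[_ * _]/(_ *m _) mul_delta_mx.
rewrite big1 ?addr0 // => i il.
by rewrite -scalerAl -[_ * _]/(_ *m _) mul_delta_mx_0 ?scaler0.
Qed.

Lemma mul_delta_mxr (a : Mn) j l :
  delta_mx j l * a = \sum_m a l m *: (delta_mx j m : Mn).
Proof.
rewrite [a in LHS]matrix_sum_delta exchange_big mulr_sumr; apply: eq_bigr => m _.
rewrite mulr_sumr (bigD1 l) //= -scalerAr -[_ * _]/(_ *m _) mul_delta_mx.
rewrite big1 ?addr0 // => i il.
by rewrite -scalerAr -[_ * _]/(_ *m _) mul_delta_mx_0 ?scaler0 // eq_sym.
Qed.

Lemma mul_delta_mx_delta (a : Mn) i j l m :
  delta_mx i j * a * delta_mx l m = a j l *: (delta_mx i m : Mn).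
Proof.
rewrite mul_delta_mxr mulr_suml (big_only1 l) // => [|s sl _]; rewrite -scalerAl.
  by rewrite -[_ * _]/(_ *m _) mul_delta_mx.
by rewrite -[_ * _]/(_ *m _) mul_delta_mx_0 ?scaler0.
Qed.

Variables (B : algType k) (f : {lrmorphism B -> Mn}).

(** The separability element of [M_n(k)] over [k] attached to the index [j],
    mapped to the tensor square over [B]. *)
Definition mx_casimir (j : 'I_n.+1) : tensor_square f :=
  \sum_l otimes f (delta_mx l j) (delta_mx j l).

(** Both sides expand to the sum of the [a m l *: (E m j (x) E j l)]. *)
Lemma mx_casimirC j (a : Mn) : lact a (mx_casimir j) = ract (mx_casimir j) a.
Proof.
rewrite lact_sum ract_sum.
transitivity (\sum_l \sum_m otimes f (a m l *: delta_mx m j) (delta_mx j l)).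
  by apply: eq_bigr => l _; rewrite lact_otimes mul_mx_delta otimes_suml.
rewrite exchange_big; apply: eq_bigr => m _.
rewrite ract_otimes mul_delta_mxr otimes_sumr.
by apply: eq_bigr => l _; apply: otimesZ.
Qed.

Lemma delta_mx_casimir j :
  lact (delta_mx j j : Mn) (mx_casimir j) = otimes f (delta_mx j j) (delta_mx j j).
Proof.
rewrite lact_sum (big_only1 j) // => [|l lj _]; rewrite lact_otimes.
  by rewrite -[_ * _]/(_ *m _) mul_delta_mx.
by rewrite -[_ * _]/(_ *m _) mul_delta_mx_0 ?otimes0l // eq_sym.
Qed.

End MatrixCasimir.

(** * Diagonal and triangular matrices *)

Section DiagonalTriangular.
Variables (k : fieldType) (n : nat).
Local Notation Mn := 'M[k]_n.+1.

Lemma delta_diag (i : 'I_n.+1) : (delta_mx i i : Mn) \in @diagp k n.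
Proof.
apply/is_diag_mxP => p q pq; rewrite mxE; case: eqP => // pi; case: eqP => // qi.
by rewrite pi qi eqxx in pq.
Qed.

Lemma delta_triu (i j : 'I_n.+1) :
  (i <= j)%N -> (delta_mx i j : Mn) \in @triup k n.
Proof.
move=> ij; apply/triupP => p q qp; rewrite mxE.
by case: eqP => // pi; case: eqP => // qj; rewrite pi qj ltnNge ij in qp.
Qed.

(** [1 (x) 1 = \sum_i E i i (x) E i i], since the diagonal idempotents can be
    moved across the tensor sign; the [i]-th term is [E i i] times the [i]-th Casimir
    element. *)
Lemma H_separable_Diag : H_separable (@Diag_val k n).
Proof.
apply: (@H_separable_casimir _ _ _ (@Diag_val k n) n.+1
          (mx_casimir (@Diag_val k n)) (fun i => delta_mx i i)) => [//|i a|i b|].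
- exact: mx_casimirC.
- rewrite mul_mx_delta mul_delta_mxr; apply: eq_bigr => m _.
  have [->//|mi] := eqVneq m i; have /is_diag_mxP bd := valP b.
  by rewrite !bd ?scale0r // eq_sym.
- rewrite [X in otimes _ X _]mx1_sum_delta otimes_suml; apply: eq_bigr => i _.
  rewrite delta_mx_casimir; pose d := MkDiag (delta_diag i).
  transitivity (otimes (@Diag_val k n) (delta_mx i i * Diag_val d) 1).
    by rewrite otimesA mulr1.
  by rewrite -[_ * _]/(delta_mx i i *m delta_mx i i) mul_delta_mx.
Qed.

(** Each [E 0 l] is upper triangular, so [E l 0 (x) E 0 l = E l l (x) 1] and the
    Casimir element for the index [0] is [1 (x) 1]. *)
Lemma H_separable_Triu : H_separable (@Triu_val k n).
Proof.
apply: (@H_separable_casimir _ _ _ (@Triu_val k n) 1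
          (fun=> mx_casimir (@Triu_val k n) ord0) (fun=> 1)) => [//|i a|i b|].
- exact: mx_casimirC.
- by rewrite mul1r mulr1.
- rewrite big_ord1 lact1 [X in otimes _ X _]mx1_sum_delta otimes_suml.
  apply: eq_bigr => l _.
  pose u : Triu k n := MkTriu (@delta_triu ord0 l (leq0n l)).
  rewrite -[delta_mx ord0 l]mulr1 -(otimesA _ _ u).
  by rewrite -[_ * _]/(_ *m _) mul_delta_mx.
Qed.

(** [t = u (x) c], with [u] and [c] the last matrix units of the first and the
    last row, would be a right multiple of [u] if the tensor square were a
    retract of a power; the functional [phi] excludes it. *)
Lemma not_left_D2_Diag_in_Triu : (0 < n)%N -> ~ left_D2 (@Diag_in_Triu k n).
Proof.
move=> n_gt0 [N _ /retract_dsummand[p [q [[_ pL pR] [qD qL qR] pK]]]].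
have [||x b y|phi phiE] := @otimes_lift _ _ _ (@Diag_in_Triu k n) k
  (fun x y => (x : Mn) ord0 ord_max * (y : Mn) ord_max ord_max).
- by move=> x x' y; rewrite raddfD mxE mulrDl.
- by move=> x y y'; rewrite raddfD mxE mulrDr.
- (* Both sides are [x 0 m * b m m * y m m] for the last index [m]. *)
  have /is_diag_mxP bd := valP b.
  rewrite !rmorphM /= !mxE (big_only1 ord_max) // => [|l lm _]; last first.
    by rewrite bd ?mulr0.
  rewrite [in RHS](big_only1 ord_max) // => [|l lm _]; last first.
    by rewrite bd ?mul0r // eq_sym.
  by rewrite mulrA.
pose u : Triu k n := MkTriu (@delta_triu ord0 ord_max (leq0n _)).
pose d : Diag k n := MkDiag (delta_diag ord0).
pose c : Triu k n := MkTriu (@delta_triu ord_max ord_max (leqnn _)).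
pose t := otimes (@Diag_in_Triu k n) u c.
have du : Diag_in_Triu d * u = u by apply: val_inj; apply: mul_delta_mx.
have cc : c * c = c by apply: val_inj; apply: mul_delta_mx.
have tE : t = lact (Diag_in_Triu d) (ract t c).
  by rewrite ract_otimes lact_otimes cc du.
(* By [tE], each entry of [p t] is a multiple of [u = E 0 0 * u]. *)
pose v : {ffun 'I_N -> Triu k n} := p t.
pose w : {ffun 'I_N -> Triu k n} :=
  [ffun i => (v i : Mn) ord0 ord_max *: Diag_in_Triu d].
have vE i : v i = w i * u.
  have -> : v i = Diag_in_Triu d * (v i * c).
    by rewrite /v [in LHS]tE pL pR !ffunE.
  rewrite ffunE; apply: val_inj; rewrite mulrA.
  transitivity (delta_mx ord0 ord0 * (v i : Mn) * delta_mx ord_max ord_max).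
    by [].
  rewrite mul_delta_mx_delta -(@mul_delta_mx _ _ _ _ (@ord0 n) ord0 ord_max).
  exact: scalemxAl.
have tw : t = ract (q w) u.
  by rewrite -qR -[t]pK; congr q; apply/ffunP=> i; rewrite ffunE; exact: vE.
have phi_t : phi t = 1 by rewrite phiE !mxE !eqxx mulr1.
have phi_u z : phi (ract z u) = 0.
  elim/otimes_ind: z => [x y IHx IHy|x y].
    by rewrite ractB raddfB IHx IHy subrr.
  (* The diagonal entry of [y * u] in the last row is [y] at [(last, 0)], below
     the diagonal since [0 < n]. *)
  have /triupP y_triu := valP y.
  rewrite ract_otimes phiE rmorphM mxE big1 ?mulr0 // => l _.
  have [->|l_neq0] := eqVneq l ord0; first by rewrite y_triu ?mul0r.
  by rewrite [X in _ * X]mxE (negbTE l_neq0) mulr0.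
by have := oner_neq0 k; rewrite -phi_t tw phi_u eqxx.
Qed.

End DiagonalTriangular.

Theorem proposition3p1 (k : fieldType) (n : nat) :
  [/\ H_separable (@Diag_val k n) /\ D2 (@Diag_val k n),
      H_separable (@Triu_val k n) /\ D2 (@Triu_val k n)
    & (2 <= n.+1)%N -> ~ D2 (@Diag_in_Triu k n)].
Proof.
split; last by move=> n_gt0 [/(not_left_D2_Diag_in_Triu n_gt0)].
- by split; [|apply: H_separable_D2]; apply: H_separable_Diag.
- by split; [|apply: H_separable_D2]; apply: H_separable_Triu.
Qed.
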